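(* There are infinitely many pairwise non-isomorphic finite graphs $G$ with $D^{\mathrm{pre}}(G)\ge T(D(G)-8)$.
   Context: The tower function is $T(0)=1$, $T(i)=2^{T(i-1)}$. Graphs are simple undirected graphs viewed as structures for the first-order language with adjacency symbol $\sim$ and equality. A sentence defines a finite graph $G$ if it is true on $G$ and false on every graph (of any cardinality) not isomorphic to $G$. $D(G)$ is the minimum quantifier rank (maximum number of nested quantifiers) of a sentence defining $G$, and $D^{\mathrm{pre}}(G)$ is the minimum quantifier rank (number of quantifiers) of a closed prenex formula (all quantifiers up front) defining $G$. *)

(* Defs.v *)
From mathcomp Require Import all_boot.
Set Implicit Arguments. Unset Strict Implicit. Unset Printing Implicit Defensive.

Fixpoint tower (n : nat) : nat := if n is n'.+1 then 2 ^ tower n' else 1.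

Record FinGraph := MkFinGraph {
  fvert : finType;
  fadj : rel fvert;
  fadj_sym : symmetric fadj;
  fadj_irr : irreflexive fadj }.

Inductive form : Type :=
| FAdj : nat -> nat -> form
| FEq : nat -> nat -> form
| FTrue : form
| FFalse : form
| FNot : form -> form
| FAnd : form -> form -> form
| FOr : form -> form -> form
| FImp : form -> form -> form
| FEx : nat -> form -> form
| FAll : nat -> form -> form.

Fixpoint qrank (f : form) : nat :=
  match f with
  | FAdj _ _ | FEq _ _ | FTrue | FFalse => 0
  | FNot g => qrank g
  | FAnd g h | FOr g h | FImp g h => maxn (qrank g) (qrank h)
  | FEx _ g | FAll _ g => (qrank g).+1
  end.

Fixpoint freevars (f : form) : seq nat :=
  match f with
  | FAdj x y | FEq x y => [:: x; y]
  | FTrue | FFalse => [::]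
  | FNot g => freevars g
  | FAnd g h | FOr g h | FImp g h => freevars g ++ freevars h
  | FEx x g | FAll x g => filter (fun y => y != x) (freevars g)
  end.

Definition closed (f : form) : Prop := freevars f = [::].

Fixpoint qfree (f : form) : bool :=
  match f with
  | FAdj _ _ | FEq _ _ | FTrue | FFalse => true
  | FNot g => qfree g
  | FAnd g h | FOr g h | FImp g h => qfree g && qfree h
  | FEx _ _ | FAll _ _ => false
  end.

Inductive prenex : form -> Prop :=
| prenex_qf f : qfree f -> prenex f
| prenex_ex x f : prenex f -> prenex (FEx x f)
| prenex_all x f : prenex f -> prenex (FAll x f).

Definition upd (V : Type) (e : nat -> V) (x : nat) (v : V) : nat -> V :=
  fun n => if n == x then v else e n.

Fixpoint sat (V : Type) (A : V -> V -> Prop) (e : nat -> V) (f : form) : Prop :=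
  match f with
  | FAdj x y => A (e x) (e y)
  | FEq x y => e x = e y
  | FTrue => True
  | FFalse => False
  | FNot g => ~ sat A e g
  | FAnd g h => sat A e g /\ sat A e h
  | FOr g h => sat A e g \/ sat A e h
  | FImp g h => sat A e g -> sat A e h
  | FEx x g => exists v : V, sat A (upd e x v) g
  | FAll x g => forall v : V, sat A (upd e x v) g
  end.

(* truth of a sentence (assignment irrelevant for closed formulas) *)
Definition holds (V : Type) (A : V -> V -> Prop) (f : form) : Prop :=
  forall e : nat -> V, sat A e f.

Definition iso (G : FinGraph) (W : Type) (B : W -> W -> Prop) : Prop :=
  exists (h : fvert G -> W) (g : W -> fvert G),
    cancel h g /\ cancel g h /\
    forall x y : fvert G, fadj x y <-> B (h x) (h y).

Definition fiso (G H : FinGraph) : Prop :=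
  iso G (fun x y : fvert H => fadj x y).

Definition defines (G : FinGraph) (f : form) : Prop :=
  closed f /\
  holds (fun x y : fvert G => fadj x y) f /\
  (forall (W : Type) (B : W -> W -> Prop),
      inhabited W -> (forall x y, B x y -> B y x) -> (forall x, ~ B x x) ->
      ~ iso G B -> ~ holds B f).

Definition isD (G : FinGraph) (d : nat) : Prop :=
  (exists f, defines G f /\ qrank f = d) /\
  (forall f, defines G f -> d <= qrank f).

Definition isDpre (G : FinGraph) (d : nat) : Prop :=
  (exists f, prenex f /\ defines G f /\ qrank f = d) /\
  (forall f, prenex f -> defines G f -> d <= qrank f).

(* Main.v *)
(* A counting argument.  Up to equivalence on finite graphs there are at most
   2 ^ (k + 4 ^ (k * k)) prenex sentences with k quantifiers, since such a sentence is
   determined by its quantifier pattern and a Boolean function of the atomic diagram of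
   a k-tuple.  On the other hand there are more than tower (m + 1) pairwise
   non-isomorphic graphs in which every vertex is isolated by a formula of rank m + 3, so
   that each of them has a defining sentence of rank m + 5.  These graphs are layered:
   a vertex of layer j + 1 is determined by its set of neighbours in layer j, so that
   one quantifier yields one exponential; layer 0 is an asymmetric union of triangles,
   the only ones in the graph, and a single vertex on top is joined to an arbitrary
   subset of layer m.  By the pigeonhole principle one of them needs tower (m - 3)
   quantifiers in prenex form. *)
Require Import Defs.
From mathcomp Require Import all_boot zify.
From Stdlib Require Import Classical ClassicalEpsilon FunctionalExtensionality.
Set Implicit Arguments. Unset Strict Implicit. Unset Printing Implicit Defensive.

(** * Semantics: coincidence, isomorphism invariance, finite connectives *)

Lemma eq_sat (V : Type) (A : V -> V -> Prop) (f : form) (e e' : nat -> V) :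
  {in freevars f, e =1 e'} -> sat A e f <-> sat A e' f.
Proof.
elim: f e e' => //= [x y|x y|g IH|g IHg h IHh|g IHg h IHh|g IHg h IHh|x g IH|x g IH] e e' H.
- by rewrite !H // !inE eqxx ?orbT.
- by rewrite !H // !inE eqxx ?orbT.
- by rewrite (IH e e').
- by rewrite (IHg e e') ?(IHh e e') // => z hz; apply: H; rewrite mem_cat hz ?orbT.
- by rewrite (IHg e e') ?(IHh e e') // => z hz; apply: H; rewrite mem_cat hz ?orbT.
- by rewrite (IHg e e') ?(IHh e e') // => z hz; apply: H; rewrite mem_cat hz ?orbT.
- have E v : sat A (upd e x v) g <-> sat A (upd e' x v) g.
    apply: IH => z hz; rewrite /upd; case: eqP => // /eqP zx.
    by apply: H; rewrite mem_filter zx.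
  by split=> -[v hv]; exists v; apply/E.
- have E v : sat A (upd e x v) g <-> sat A (upd e' x v) g.
    apply: IH => z hz; rewrite /upd; case: eqP => // /eqP zx.
    by apply: H; rewrite mem_filter zx.
  by split=> hv v; apply/E.
Qed.

Lemma sat_iso (V W : Type) (A : V -> V -> Prop) (B : W -> W -> Prop)
    (h : V -> W) (g : W -> V) (f : form) (e : nat -> V) :
  cancel h g -> cancel g h -> (forall x y, A x y <-> B (h x) (h y)) ->
  sat A e f <-> sat B (h \o e) f.
Proof.
move=> hK gK hAB.
have updE (e0 : nat -> V) x v : h \o upd e0 x v = upd (h \o e0) x (h v).
  by apply: functional_extensionality => n; rewrite /upd /=; case: ifP.
elim: f e => //= [x y|p IH|p IHp q IHq|p IHp q IHq|p IHp q IHq|x p IH|x p IH] e.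
- by split=> [->//|/(can_inj hK)].
- by rewrite IH.
- by rewrite IHp IHq.
- by rewrite IHp IHq.
- by rewrite IHp IHq.
- split=> [[v]|[w]]; first by rewrite IH updE; exists (h v).
  by move=> H; exists (g w); rewrite IH updE gK.
- split=> H v; last by rewrite IH updE.
  by rewrite -(gK v) -updE -IH.
Qed.

Section Connectives.
Variable T : eqType.
Implicit Types (F : T -> form) (s : seq T).

Definition conj_over F s := foldr (fun v g => FAnd (F v) g) FTrue s.
Definition disj_over F s := foldr (fun v g => FOr (F v) g) FFalse s.

Lemma sat_conj V (A : V -> V -> Prop) e F s :
  sat A e (conj_over F s) <-> (forall v, v \in s -> sat A e (F v)).
Proof.
elim: s => [|v s IH] //=; rewrite IH; split=> [[hv hs] w|H].
  by rewrite inE => /orP[/eqP->|/hs].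
by split=> [|w hw]; apply: H; rewrite inE ?eqxx ?hw ?orbT.
Qed.

Lemma sat_disj V (A : V -> V -> Prop) e F s :
  sat A e (disj_over F s) <-> (exists2 v, v \in s & sat A e (F v)).
Proof.
elim: s => [|v s IH] /=; first by split=> // -[].
rewrite IH; split=> [[hv|[w hw H]]|[w]].
- by exists v; rewrite ?inE ?eqxx.
- by exists w; rewrite ?inE ?hw ?orbT.
- by rewrite inE => /orP[/eqP->|hw] H; [left|right; exists w].
Qed.

Lemma qrank_conj F s r : (forall v, qrank (F v) <= r) -> qrank (conj_over F s) <= r.
Proof. by move=> H; elim: s => //= v s IH; rewrite geq_max H. Qed.

Lemma qrank_disj F s r : (forall v, qrank (F v) <= r) -> qrank (disj_over F s) <= r.
Proof. by move=> H; elim: s => //= v s IH; rewrite geq_max H. Qed.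

Lemma freevars_conj F s (X : seq nat) :
  (forall v, {subset freevars (F v) <= X}) -> {subset freevars (conj_over F s) <= X}.
Proof.
by move=> H; elim: s => //= v s IH z; rewrite mem_cat => /orP[/H|/IH].
Qed.

Lemma freevars_disj F s (X : seq nat) :
  (forall v, {subset freevars (F v) <= X}) -> {subset freevars (disj_over F s) <= X}.
Proof.
by move=> H; elim: s => //= v s IH z; rewrite mem_cat => /orP[/H|/IH].
Qed.

Lemma qfree_conj F s : (forall v, qfree (F v)) -> qfree (conj_over F s).
Proof. by move=> H; elim: s => //= v s ->; rewrite H. Qed.

Lemma qfree_disj F s : (forall v, qfree (F v)) -> qfree (disj_over F s).
Proof. by move=> H; elim: s => //= v s ->; rewrite H. Qed.

End Connectives.

Lemma closedP (f : form) : {subset freevars f <= [::]} -> Defs.closed f.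
Proof. by rewrite /Defs.closed; case: (freevars f) => // x s /(_ x (mem_head _ _)). Qed.

(** Both maps are chosen from [R]; the equality clause makes [R] single-valued both ways, hence the
    maps mutually inverse. [R v x] will say that [x] satisfies the formula attached to [v]. *)
Lemma iso_of_relation (G : FinGraph) (W : Type) (B : W -> W -> Prop)
    (R : fvert G -> W -> Prop) :
  (forall v, exists x, R v x) -> (forall x, exists v, R v x) ->
  (forall v w x y, R v x -> R w y -> (x = y <-> v = w) /\ (B x y <-> fadj v w)) ->
  iso G B.
Proof.
move=> tot sur hR.
pose h v := proj1_sig (constructive_indefinite_description _ (tot v)).
pose g x := proj1_sig (constructive_indefinite_description _ (sur x)).
have hP v : R v (h v) := proj2_sig (constructive_indefinite_description _ (tot v)).
have gP x : R (g x) x := proj2_sig (constructive_indefinite_description _ (sur x)).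
exists h, g; split=> [v|]; first by apply/(hR _ _ _ _ (gP (h v)) (hP v)).1.
split=> [x|v w]; first by apply/(hR _ _ _ _ (hP (g x)) (gP x)).1.
by split=> /(hR _ _ _ _ (hP v) (hP w)).2.
Qed.

(** * Unary definable predicates *)

Definition upred := forall W : Type, (W -> W -> Prop) -> W -> Prop.

(* Asking for a formula in each variable [x] makes substitution of one variable
   for another available without a renaming operation on formulas. *)
Definition udef (r : nat) (P : upred) : Prop :=
  forall x : nat, exists f : form,
    [/\ qrank f <= r, {subset freevars f <= [:: x]} &
        forall (W : Type) (B : W -> W -> Prop) e, sat B e f <-> P W B (e x)].

Lemma udef_leq r r' P : r <= r' -> udef r P -> udef r' P.
Proof.
by move=> le H x; have [f [hr hf hs]] := H x; exists f; split=> //; apply: leq_trans le.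
Qed.

Lemma udef_not r P : udef r P -> udef r (fun W B w => ~ P W B w).
Proof.
move=> H x; have [f [hr hf hs]] := H x.
by exists (FNot f); split=> //= W B e; rewrite hs.
Qed.

Lemma udef_and r P Q : udef r P -> udef r Q -> udef r (fun W B w => P W B w /\ Q W B w).
Proof.
move=> HP HQ x; have [f [hr hf hs]] := HP x; have [g [kr kf ks]] := HQ x.
exists (FAnd f g); split=> /= [|z|W B e]; first by rewrite geq_max hr.
  by rewrite mem_cat => /orP[/hf|/kf].
by rewrite hs ks.
Qed.

(** The only step that raises the rank when climbing a layer. The formula for [P] is taken in the
    fresh variable [x.+1], so the new quantifier does not capture [x]. *)
Lemma udef_nbr r P : udef r P -> udef r.+1 (fun W B w => exists2 y, B w y & P W B y).
Proof.
move=> HP x; have [f [hr hf hs]] := HP x.+1.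
have xS : (x == x.+1) = false by rewrite ltn_eqF.
exists (FEx x.+1 (FAnd (FAdj x x.+1) f)); split=> /= [|z|W B e]; first by rewrite max0n.
  rewrite xS /= eqxx /= !inE mem_filter => /orP[->//|/andP[zx /hf]].
  by rewrite inE (negPf zx).
split=> [[v]|[v Bv Pv]]; [|exists v]; rewrite hs /upd eqxx xS //.
by case; exists v.
Qed.

Lemma udef_conj (T : eqType) r (P : T -> upred) (s : seq T) :
  {in s, forall u, udef r (P u)} ->
  udef r (fun W B w => forall u, u \in s -> P u W B w).
Proof.
elim: s => [|u s IH] H x.
  by exists FTrue; split.
have [|f [hr hf hs]] := IH _ x.
  by move=> v vs; apply: H; rewrite inE vs orbT.
have [|g [kr kf ks]] := H u _ x; first exact: mem_head.
exists (FAnd g f); split=> /= [|z|W B e]; first by rewrite geq_max hr kr.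
  by rewrite mem_cat => /orP[/kf|/hf].
rewrite hs ks; split=> [[Pu Ps] v|Ps].
  by rewrite inE => /orP[/eqP->|/Ps].
by split=> [|v vs]; apply: Ps; rewrite inE ?eqxx ?vs ?orbT.
Qed.

Definition in_triangle : upred := fun W B w =>
  exists y z, [/\ B w y, B w z & B y z].

(** Within layer 0 this marks the gadget vertices 0 and 1, the ones with neighbours in layer 1. *)
Definition off_triangle_edge : upred := fun W B w =>
  exists y, B w y /\ forall z, ~ (B w z /\ B y z).

(** The fan at [w]: two triangles sharing the edge from [w] to [b]. It tells gadget vertex 0 from
    1. *)
Definition two_triangles : upred := fun W B w =>
  exists a b c, [/\ B w a, B w b, B w c, B a b & B b c] /\ a <> c.

Lemma succ_neqs n :
  ((n == n.+1) = false) * ((n == n.+2) = false) * ((n == n.+3) = false) *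
  ((n.+1 == n) = false) * ((n.+2 == n) = false) * ((n.+3 == n) = false).
Proof. by do !split; apply/eqP; lia. Qed.

Lemma udef_in_triangle : udef 2 in_triangle.
Proof.
move=> x; exists (FEx x.+1 (FEx x.+2
  (FAnd (FAdj x x.+1) (FAnd (FAdj x x.+2) (FAdj x.+1 x.+2))))).
split=> //= [z|W B e].
  by do 4!rewrite ?(eqSS, succ_neqs, eqxx) /=; rewrite !inE ?orbb.
rewrite /upd !eqSS !succ_neqs !eqxx.
split=> [[y [z [? [? ?]]]]|[y [z [? ? ?]]]]; exists y, z; by split.
Qed.

Lemma udef_off_triangle_edge : udef 2 off_triangle_edge.
Proof.
move=> x; exists (FEx x.+1 (FAnd (FAdj x x.+1) (FAll x.+2
  (FNot (FAnd (FAdj x x.+2) (FAdj x.+1 x.+2)))))).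
split=> //= [z|W B e].
  by do 4!rewrite ?(eqSS, succ_neqs, eqxx) /=; rewrite !inE ?orbb.
by rewrite /upd !eqSS !succ_neqs !eqxx.
Qed.

Lemma udef_two_triangles : udef 3 two_triangles.
Proof.
move=> x; exists (FEx x.+1 (FEx x.+2 (FEx x.+3
  (FAnd (FAnd (FAdj x x.+1) (FAnd (FAdj x x.+2) (FAnd (FAdj x x.+3)
    (FAnd (FAdj x.+1 x.+2) (FAdj x.+2 x.+3)))))
    (FNot (FEq x.+1 x.+3)))))).
split=> //= [z|W B e].
  by do 4!rewrite ?(eqSS, succ_neqs, eqxx) /=; rewrite !inE ?orbb.
rewrite /upd !eqSS !succ_neqs !eqxx.
split=> [[a [b [c [[? [? [? [? ?]]]] ?]]]]|[a [b [c [[? ? ? ? ?] ?]]]]];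
  by exists a, b, c.
Qed.

Lemma udef_iso r P (V W : Type) (A : V -> V -> Prop) (B : W -> W -> Prop)
    (h : V -> W) (g : W -> V) (v : V) :
  udef r P -> cancel h g -> cancel g h -> (forall x y, A x y <-> B (h x) (h y)) ->
  P V A v <-> P W B (h v).
Proof.
move=> HP hK gK hAB; have [f [_ _ fP]] := HP 0.
by rewrite -(fP V A (fun=> v)) (sat_iso _ _ hK gK hAB) fP.
Qed.

(* The defining sentence says that the isolating formulas carve the structure
   into singletons whose equality and adjacency pattern is that of [G]. *)
Lemma defines_of_isolated (G : FinGraph) r (P : fvert G -> upred) :
  (forall v, udef r (P v)) ->
  (forall v w, P v (fvert G) (fun x y => fadj x y) w <-> w = v) ->
  exists2 f, defines G f & qrank f <= r.+2.
Proof.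
move=> HP PG.
have [F0 F0P] := fin_all_exists (fun v => HP v 0).
have [F1 F1P] := fin_all_exists (fun v => HP v 1).
pose agree (vw : fvert G * fvert G) := FAnd
  (if vw.1 == vw.2 then FEq 0 1 else FNot (FEq 0 1))
  (if fadj vw.1 vw.2 then FAdj 0 1 else FNot (FAdj 0 1)).
pose pairs := conj_over (fun vw : fvert G * fvert G =>
  FImp (FAnd (F0 vw.1) (F1 vw.2)) (agree vw)) (enum predT).
pose f := FAnd (conj_over (fun v => FEx 0 (F0 v)) (enum predT))
  (FAnd (FAll 0 (disj_over F0 (enum predT))) (FAll 0 (FAll 1 pairs))).
have satf W (B : W -> W -> Prop) e : sat B e f <->
    [/\ forall v, exists x, P v W B x, forall x, exists v, P v W B x &
        forall v w x y, P v W B x -> P w W B y ->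
          (x = y <-> v = w) /\ (B x y <-> fadj v w)].
  have F0E v e' : sat B e' (F0 v) <-> P v W B (e' 0) by have [_ _ ->] := F0P v.
  have F1E v e' : sat B e' (F1 v) <-> P v W B (e' 1) by have [_ _ ->] := F1P v.
  have agreeE e' vw : sat B e' (agree vw) <->
      (e' 0 = e' 1 <-> vw.1 = vw.2) /\ (B (e' 0) (e' 1) <-> fadj vw.1 vw.2).
    by rewrite /agree /=; case: eqP; case: (fadj _ _) => /=; intuition.
  rewrite /= sat_conj; split.
    move=> [h1 [h2 h3]]; split=> [v|x|v w x y Pv Pw].
    - by have [|x /F0E Px] := h1 v; rewrite ?mem_enum //; exists x.
    - by have /sat_disj[v _ /F0E Pv] := h2 x; exists v.
    - have /sat_conj/(_ (v, w)) := h3 x y; rewrite mem_enum => /(_ isT).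
      by case=> [|ha hb]; [split; [apply/F0E | apply/F1E] | move/agreeE: (conj ha hb)].
  move=> [h1 h2 h3]; split=> [v _|].
    by have [x Px] := h1 v; exists x; apply/F0E.
  split=> [x|x y].
    by have [v Pv] := h2 x; apply/sat_disj; exists v; rewrite ?mem_enum //; apply/F0E.
  apply/sat_conj => -[v w] _ [/F0E Pv /F1E Pw]; apply/agreeE.
  exact: h3 Pv Pw.
exists f; last first.
  rewrite /f /= !geq_max; apply/and3P; split.
  - by apply: qrank_conj => v /=; have [? _ _] := F0P v; lia.
  - by rewrite ltnS; apply: leqW; apply: qrank_disj => v; have [? _ _] := F0P v.
  - rewrite !ltnS; apply: qrank_conj => -[v w] /=.
    have [? _ _] := F0P v; have [? _ _] := F1P w.
    by rewrite /agree /=; case: ifP; case: ifP; rewrite /= ?maxn0; lia.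
have F0fv v z : z \in freevars (F0 v) -> z = 0.
  by have [_ h _] := F0P v; move/h; rewrite inE => /eqP.
have F1fv v z : z \in freevars (F1 v) -> z = 1.
  by have [_ h _] := F1P v; move/h; rewrite inE => /eqP.
split; [|split].
- apply: closedP => z; rewrite /f /= !mem_cat => /or3P[].
  + apply: freevars_conj => v y /=; rewrite mem_filter => /andP[+ /F0fv yE].
    by rewrite yE.
  + rewrite mem_filter => /andP[z0] H.
    suff : z \in [:: 0] by rewrite inE (negPf z0).
    by apply: freevars_disj H => v y /F0fv->.
  + rewrite !mem_filter => /and3P[z0 z1] H.
    suff : z \in [:: 0; 1] by rewrite !inE (negPf z0) (negPf z1).
    apply: freevars_conj H => -[v w] y /=; rewrite !mem_cat => /orP[/orP[]|].
    * by move/F0fv->.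
    * by move/F1fv->.
    * by rewrite /agree; case: ifP; case: ifP => _ _ /=; rewrite !inE -?orbA; case: eqP; case: eqP.
- move=> e; apply/satf; split=> [v|x|v w x y].
  + by exists v; apply/PG.
  + by exists x; apply/PG.
  + by move=> /PG-> /PG->.
- move=> W B [x0] _ _ niso /(_ (fun=> x0))/satf[h1 h2 h3].
  exact: niso (iso_of_relation h1 h2 h3).
Qed.

(** * Prenex sentences *)

Fixpoint exs n g := if n is n'.+1 then exs n' (FEx n' g) else g.

Lemma sat_exs V (A : V -> V -> Prop) n g e :
  sat A e (exs n g) <-> exists2 e', (forall k, n <= k -> e' k = e k) & sat A e' g.
Proof.
elim: n g e => [|n IH] g e /=.
  split=> [H|[e' He']]; first by exists e.
  by have -> : e' = e by apply: functional_extensionality => k; apply: He'.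
rewrite IH; split=> [[e' He' /= [v Hv]]|[e' He' H]].
  by exists (upd e' n v) => // k lt; rewrite /upd gtn_eqF // He' // ltnW.
exists (upd e' n (e n)).
  by move=> k; rewrite /upd leq_eqVlt eq_sym; case: eqP => [->|_ /= /He'].
exists (e' n).
have -> // : upd (upd e' n (e n)) n (e' n) = e'.
by apply: functional_extensionality => k; rewrite /upd; case: eqP => // ->.
Qed.

Lemma mem_freevars_exs n g x : (x \in freevars (exs n g)) = (n <= x) && (x \in freevars g).
Proof.
elim: n g => //= n IH g; rewrite IH /= mem_filter andbA; congr (_ && _).
by rewrite [n < x]ltn_neqAle andbC eq_sym.
Qed.

Lemma prenex_exs n g : prenex g -> prenex (exs n g).
Proof. by elim: n g => //= n IH g Hg; apply: IH; apply: prenex_ex. Qed.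

(** The sentence lists all vertices with their atomic diagram and says that every element is listed.
    It guarantees that a least prenex rank exists. *)
Lemma prenex_defines (G : FinGraph) : exists2 f, prenex f & defines G f.
Proof.
pose n := #|fvert G|; pose rk (v : fvert G) : nat := enum_rank v.
pose agree (vw : fvert G * fvert G) := FAnd
  (if vw.1 == vw.2 then FEq (rk vw.1) (rk vw.2) else FNot (FEq (rk vw.1) (rk vw.2)))
  (if fadj vw.1 vw.2 then FAdj (rk vw.1) (rk vw.2) else FNot (FAdj (rk vw.1) (rk vw.2))).
pose g := FAnd (conj_over agree (enum predT))
               (disj_over (fun v => FEq n (rk v)) (enum predT)).
have rkn v : rk v < n by apply: ltn_ord.
exists (exs n (FAll n g)).
  apply/prenex_exs/prenex_all/prenex_qf; rewrite /g /= qfree_conj ?qfree_disj //.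
  by move=> [v w]; rewrite /agree /=; case: ifP; case: ifP.
have satf W (B : W -> W -> Prop) e : sat B e (exs n (FAll n g)) <->
    exists2 e' : nat -> W, (forall k, n <= k -> e' k = e k) &
      (forall v w, (e' (rk v) = e' (rk w) <-> v = w) /\
                   (B (e' (rk v)) (e' (rk w)) <-> fadj v w)) /\
      forall x, exists v, x = e' (rk v).
  have updE e' x v : upd e' n x (rk v) = e' (rk v) :> W.
    by rewrite /upd ltn_eqF.
  have updn e' x : upd e' n x n = x :> W by rewrite /upd eqxx.
  have agreeE e' vw : sat B e' (agree vw) <->
      (e' (rk vw.1) = e' (rk vw.2) <-> vw.1 = vw.2) /\
      (B (e' (rk vw.1)) (e' (rk vw.2)) <-> fadj vw.1 vw.2).
    by rewrite /agree /=; case: eqP; case: (fadj _ _) => /=; intuition.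
  rewrite sat_exs; split=> -[e' ee' H]; exists e' => //.
    split=> [v w|x].
      have [/sat_conj/(_ (v, w)) + _] := H (e' 0).
      by rewrite mem_enum => /(_ isT)/agreeE /=; rewrite !updE.
    have [_ /sat_disj[v _ /=]] := H x.
    by rewrite updn updE; exists v.
  move=> x /=; split.
    by apply/sat_conj => -[v w] _; apply/agreeE => /=; rewrite !updE; apply: H.1.
  apply/sat_disj; have [v ->] := H.2 x.
  by exists v; rewrite ?mem_enum //= updn updE.
split; [|split].
- apply: closedP => z; rewrite mem_freevars_exs /= mem_filter mem_cat.
  case/and3P=> nz zn H; exfalso; move: H; apply/negP.
  have gtr v : (z == rk v) = false by apply: gtn_eqF; apply: leq_trans nz.
  rewrite negb_or; apply/andP; split; apply/negP => H.
    have : z \in [seq rk v | v in fvert G].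
      apply: freevars_conj H => -[v w] y /=.
      have me u : rk u \in [seq rk v | v in fvert G] by apply: image_f.
      by rewrite /agree /=; case: ifP; case: ifP => _ _ /=;
         rewrite !inE -?orbA => /or4P[] /eqP->.
    by case/imageP=> v _ /eqP; rewrite gtr.
  have : z \in n :: [seq rk v | v in fvert G].
    by apply: freevars_disj H => v y /=; rewrite !inE => /orP[]/eqP->;
       rewrite ?eqxx // image_f ?orbT.
  by rewrite inE (negPf zn) /= => /imageP[v _ /eqP]; rewrite gtr.
- move=> e; apply/satf.
  pose e' k := nth (e k) (enum (fvert G)) k.
  have e'E v : e' (rk v) = v by apply: nth_enum_rank.
  (* Past the [n] listed vertices [nth] falls back to [e k], as [sat_exs] demands. *)
  exists e' => [k nk|]; first by rewrite /e' nth_default // -cardE.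
  split=> [v w|x]; last by exists x; rewrite e'E.
  by rewrite !e'E.
- move=> W B [x0] _ _ niso /(_ (fun=> x0))/satf[e' _ [h1 h2]].
  apply: niso; apply: (@iso_of_relation _ _ _ (fun v x => x = e' (rk v))) => //.
    by move=> v; exists (e' (rk v)).
  by move=> v w x y -> ->.
Qed.

(** * Coding and counting prenex sentences *)

Fixpoint beval (a q : nat -> nat -> bool) (f : form) : bool :=
  match f with
  | FAdj x y => a x y
  | FEq x y => q x y
  | FTrue => true
  | FFalse => false
  | FNot g => ~~ beval a q g
  | FAnd g h => beval a q g && beval a q h
  | FOr g h => beval a q g || beval a q h
  | FImp g h => beval a q g ==> beval a q h
  | FEx _ _ | FAll _ _ => false
  end.

Lemma sat_beval V (A : V -> V -> Prop) (e : nat -> V) (a q : nat -> nat -> bool) f :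
  qfree f ->
  {in freevars f &, forall x y, (A (e x) (e y) <-> a x y) /\ (e x = e y <-> q x y)} ->
  sat A e f <-> beval a q f.
Proof.
elim: f => //= [x y _ H|x y _ H|g IH|g IHg h IHh|g IHg h IHh|g IHg h IHh].
- by apply: (H x y _ _).1; rewrite !inE eqxx ?orbT.
- by apply: (H x y _ _).2; rewrite !inE eqxx ?orbT.
- by move=> qg H; rewrite IH //; split=> /negP.
- move=> /andP[qg qh] H; rewrite IHg ?IHh //; first by split=> /andP.
    by move=> x y hx hy; apply: H; rewrite mem_cat ?hx ?hy orbT.
  by move=> x y hx hy; apply: H; rewrite mem_cat ?hx ?hy.
- move=> /andP[qg qh] H; rewrite IHg ?IHh //; first by split=> /orP.
    by move=> x y hx hy; apply: H; rewrite mem_cat ?hx ?hy orbT.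
  by move=> x y hx hy; apply: H; rewrite mem_cat ?hx ?hy.
- move=> /andP[qg qh] H; rewrite IHg ?IHh //; first by split=> /implyP.
    by move=> x y hx hy; apply: H; rewrite mem_cat ?hx ?hy orbT.
  by move=> x y hx hy; apply: H; rewrite mem_cat ?hx ?hy.
Qed.

Fixpoint prefix_of f : seq (bool * nat) :=
  match f with
  | FEx x g => (true, x) :: prefix_of g
  | FAll x g => (false, x) :: prefix_of g
  | _ => [::]
  end.

Fixpoint matrix_of f := match f with FEx _ g | FAll _ g => matrix_of g | _ => f end.

Lemma qfree_matrix f : qfree f -> (prefix_of f = [::]) * (matrix_of f = f) * (qrank f = 0).
Proof.
suff H : qfree f -> qrank f = 0 by move=> qf; rewrite H //; case: f qf {H}.
elim: f => //= g IHg h IHh /andP[/IHg-> /IHh->] //.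
Qed.

Lemma size_prefix_of f : prenex f -> size (prefix_of f) = qrank f.
Proof. by elim=> [g qg|x g _ IH|x g _ IH] /=; rewrite ?IH ?(qfree_matrix qg). Qed.

(** The two Booleans record adjacency and equality of two chosen vertices. The number of quantifiers
    is written [K.+1] so that [inord] can produce indices. *)
Definition diagram_type K : finType := {ffun 'I_K.+1 * 'I_K.+1 -> bool * bool}.
Definition prenex_code K : finType := ({ffun 'I_K.+1 -> bool} * {ffun diagram_type K -> bool})%type.

Section Game.
Variables (K : nat) (V : finType) (adj : rel V) (d : V).

Definition diagram (vs : seq V) : diagram_type K :=
  [ffun p : 'I_K.+1 * 'I_K.+1 => (adj (nth d vs p.1) (nth d vs p.2), nth d vs p.1 == nth d vs p.2)].

(** Evaluation without variable names: [vs] stacks the vertices chosen so far, latest first, and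
    only the final diagram matters. *)
Fixpoint game (F : diagram_type K -> bool) (bs : seq bool) (vs : seq V) : Prop :=
  match bs with
  | [::] => F (diagram vs)
  | true :: bs' => exists v, game F bs' (v :: vs)
  | false :: bs' => forall v, game F bs' (v :: vs)
  end.

(* [xs] lists the variables quantified so far, innermost first, so that [index]
   finds the binding currently in force. *)
Definition env_of (xs : seq nat) (vs : seq V) (x : nat) := nth d vs (index x xs).

Definition matrix_table (zs : seq nat) (g : form) : {ffun diagram_type K -> bool} :=
  [ffun M : diagram_type K =>
     let at_ x y := M (inord (index x zs), inord (index y zs)) in
     beval (fun x y => (at_ x y).1) (fun x y => (at_ x y).2) g].

(** Each quantifier moves its variable from the prefix to the head of [xs], which leaves the
    [catrev] list unchanged. The size condition makes the final list have exactly [K.+1] entries, so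
    every index used by the matrix is in range. *)
Lemma sat_game f : prenex f -> forall xs vs,
  {subset freevars f <= xs} -> size xs + qrank f = K.+1 ->
  sat (fun x y => adj x y) (env_of xs vs) f <->
  game (matrix_table (catrev (unzip2 (prefix_of f)) xs) (matrix_of f))
       (unzip1 (prefix_of f)) vs.
Proof.
have updE x xs vs v : upd (env_of xs vs) x v = env_of (x :: xs) (v :: vs).
  by apply: functional_extensionality => z; rewrite /upd /env_of /= eq_sym; case: ifP.
have subE x g xs : {subset [seq y <- freevars g | y != x] <= xs} ->
    {subset freevars g <= x :: xs}.
  move=> sub z hz; rewrite inE; case: eqP => //= /eqP zx; apply: sub.
  by rewrite mem_filter zx.
elim=> [g qg|x g _ IH|x g _ IH] xs vs /= sub sz.
- rewrite !qfree_matrix //= /matrix_table ffunE; apply: sat_beval => // x y /sub hx /sub hy.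
  have lt z : z \in xs -> index z xs < K.+1.
    by rewrite -sz qfree_matrix // addn0 index_mem.
  rewrite !ffunE /= !inordK ?lt //; split; first by [].
  by split=> /eqP.
- have E v := IH (x :: xs) (v :: vs) (subE _ _ _ sub) (etrans (addSnnS _ _) sz).
  by split=> -[v H]; exists v; move: H; rewrite updE E.
- have E v := IH (x :: xs) (v :: vs) (subE _ _ _ sub) (etrans (addSnnS _ _) sz).
  by split=> H v; move: (H v); rewrite updE E.
Qed.

End Game.

Definition code_of K f : prenex_code K :=
  ([ffun i : 'I_K.+1 => nth true (unzip1 (prefix_of f)) i],
   matrix_table K (catrev (unzip2 (prefix_of f)) [::]) (matrix_of f)).

Lemma eq_code_holds K f g (V : finType) (adj : rel V) :
  prenex f -> prenex g -> Defs.closed f -> Defs.closed g -> qrank f = K.+1 -> qrank g = K.+1 ->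
  code_of K f = code_of K g ->
  holds (fun x y => adj x y) f -> holds (fun x y => adj x y) g.
Proof.
move=> pf pg cf cg rf rg [/ffunP bE mE] Hf e.
have sE : unzip1 (prefix_of f) = unzip1 (prefix_of g).
  apply: (@eq_from_nth _ true); first by rewrite !size_map !size_prefix_of // rf rg.
  move=> i; rewrite size_map size_prefix_of // rf => lt.
  by have := bE (Ordinal lt); rewrite !ffunE.
(* With empty stacks every variable reads the default vertex [e 0], which is harmless for a closed
   formula. *)
have toconst h : Defs.closed h -> sat (fun x y => adj x y) e h <->
    sat (fun x y => adj x y) (env_of (e 0) [::] [::]) h.
  by move=> ch; apply: eq_sat => z; rewrite ch.
apply/toconst => //; apply/(@sat_game K) => //; rewrite ?cg //.
by rewrite -mE -sE; apply/(@sat_game K) => //; rewrite ?cf //; apply/toconst.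
Qed.

Lemma card_prenex_code K : #|prenex_code K| = 2 ^ (K.+1 + 4 ^ (K.+1 * K.+1)).
Proof. by rewrite card_prod !card_ffun !card_prod !card_bool !card_ord -expnD. Qed.

(** Dummy quantifiers in front change nothing on nonempty structures, since the formula is closed.
    Codes can thus be compared at one exact rank. *)
Lemma pad_prenex (G : FinGraph) f r :
  prenex f -> defines G f -> qrank f <= r ->
  exists g, [/\ prenex g, defines G g & qrank g = r].
Proof.
move=> pf df /subnKC <-; elim: (r - qrank f) => [|n [g [pg dg rg]]].
  by exists f; rewrite addn0.
exists (FEx 0 g); split; [exact: prenex_ex| |by rewrite /= rg addnS].
have [cg [hg ug]] := dg.
have satE W (B : W -> W -> Prop) (w : W) e : sat B e (FEx 0 g) <-> sat B e g.
  have E v : sat B (upd e 0 v) g <-> sat B e g by apply: eq_sat => z; rewrite cg.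
  by split=> [[v /E]|H]; last by exists w; apply/E.
split; [|split]; first by rewrite /Defs.closed /= cg.
- by move=> e; apply/(satE _ _ (e 0)).
- move=> W B [w] sB iB nB H; apply: (ug W B (inhabits w) sB iB nB) => e.
  by apply/(satE _ _ w).
Qed.

(** Otherwise each graph gets a defining prenex sentence with exactly [K.+1] quantifiers. Sentences
    with equal codes hold on the same finite graphs, so the code determines the graph up to
    isomorphism, against the cardinality bound. *)
Lemma exists_large_prenex_rank (I : finType) (Gs : I -> FinGraph) K :
  (forall i, inhabited (fvert (Gs i))) ->
  (forall i j, fiso (Gs i) (Gs j) -> i = j) ->
  #|prenex_code K| < #|I| ->
  exists i, forall f, prenex f -> defines (Gs i) f -> K.+1 <= qrank f.
Proof.
move=> inh inj lt; apply: NNPP => none.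
have small i : exists f, [/\ prenex f, defines (Gs i) f & qrank f = K.+1].
  apply: NNPP => H; apply: none; exists i => f pf df; rewrite leqNgt; apply/negP => le.
  by apply: H; apply: pad_prenex pf df _; lia.
have [F FP] := fin_all_exists small.
suff /leq_card : injective (fun i => code_of K (F i)) by rewrite leqNgt lt.
move=> i j E; apply: inj; have [pi di ri] := FP i; have [pj dj rj] := FP j.
apply: NNPP => nij.
have [ci [_ ui]] := di; have [cj [hj _]] := dj.
apply: (ui _ _ (inh j) _ _ nij (eq_code_holds pj pi cj ci rj ri (esym E) hj)).
- by move=> x y; rewrite fadj_sym.
- by move=> x; rewrite fadj_irr.
Qed.

(** * Binary digits and the tower function *)

Definition bit (i n : nat) : bool := odd (n %/ 2 ^ i).

Lemma bit0E n : bit 0 n = odd n.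
Proof. by rewrite /bit divn1. Qed.

Lemma bitS i n : bit i.+1 n = bit i n./2.
Proof. by rewrite /bit expnS divnMA divn2. Qed.

Lemma bit_leq i n : bit i n -> 2 ^ i <= n.
Proof. by rewrite /bit leqNgt; apply: contraL => lt; rewrite divn_small. Qed.

Lemma bit_exists n : 0 < n -> exists i, bit i n.
Proof.
elim/ltn_ind: n => n IH n0; case nodd: (odd n); first by exists 0; rewrite bit0E.
have [||i bi] := IH n./2; try lia.
by exists i.+1; rewrite bitS.
Qed.

Lemma bit_inj s a b : a < 2 ^ s -> b < 2 ^ s ->
  (forall i, i < s -> bit i a = bit i b) -> a = b.
Proof.
elim: s a b => [|s IH] a b; first by rewrite expn0; lia.
rewrite expnS => la lb H.
have := H 0 isT; rewrite !bit0E => ab.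
suff : a./2 = b./2 by lia.
by apply: IH => [||i li]; [lia|lia|rewrite -!bitS H].
Qed.

Lemma tower_gt0 n : 0 < tower n.
Proof. by case: n => //= n; rewrite expn_gt0. Qed.

Lemma tower_leq m n : m <= n -> tower m <= tower n.
Proof.
elim: n m => [|n IH] [|m] //; first by rewrite [tower 0]/= tower_gt0.
by move=> /IH le /=; rewrite leq_exp2l.
Qed.

(** * The graphs *)

(* Every edge lies in a triangle.  Only 0 and 1 will have neighbours outside, and they
   differ by the fan of two triangles (0 2 3, 0 3 4) at 0. *)
Definition gadget : seq (nat * nat) :=
  [:: (0, 2); (0, 3); (0, 4); (2, 3); (3, 4); (1, 3); (1, 4)].

Definition gadj a b := ((a, b) \in gadget) || ((b, a) \in gadget).

Section Levels.
Variable m : nat.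

(** The extra vertex in a middle layer doubles the number of available codes, to [2 * tower j.+1],
    leaving room for the next layer to use only positive ones. *)
Definition width j := if j == 0 then 5 else if j <= m then (tower j).+1 else 1.

Definition vertex : finType := {j : 'I_m.+2 & 'I_(width j)}.

Definition level (v : vertex) : nat := tag v.
Definition pos (v : vertex) : nat := tagged v.

Lemma vertex_inj v w : level v = level w -> pos v = pos w -> v = w.
Proof.
case: v w => [i a] [j b]; rewrite /level /pos /= => /val_inj ij.
by subst j => /val_inj->.
Qed.

Lemma vertex_exists j a : j <= m.+1 -> a < width j ->
  exists v, level v = j /\ pos v = a.
Proof.
move=> lj la; pose J : 'I_m.+2 := Ordinal (lj : j < m.+2).
by exists (@Tagged _ J (fun j : 'I_m.+2 => 'I_(width j)) (Ordinal la)).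
Qed.

Lemma level_leq v : level v <= m.+1.
Proof. by rewrite -ltnS ltn_ord. Qed.

Lemma pos_lt v : pos v < width (level v).
Proof. exact: ltn_ord. Qed.

Lemma width0 : width 0 = 5. Proof. by []. Qed.
Lemma width_mid j : 0 < j <= m -> width j = (tower j).+1.
Proof. by rewrite /width; case: j => //= j ->. Qed.
Lemma width_top : width m.+1 = 1. Proof. by rewrite /width ltnn. Qed.

(* A vertex above level 0 is coded by the set of its neighbours in the level below;
   codes are positive except possibly at the top, where the code is [c]. *)
Definition code c v := if level v == m.+1 then c else (pos v).+1.

Definition up c (u v : vertex) := (level v == (level u).+1) && bit (pos u) (code c v).

Definition adj c (u v : vertex) :=
  [|| up c u v, up c v u | [&& level u == 0, level v == 0 & gadj (pos u) (pos v)]].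

Lemma adj_sym c : symmetric (adj c).
Proof.
move=> u v; rewrite /adj /gadj [up c u v || _]orbCA andbCA.
by rewrite [_ || ((pos v, _) \in _)]orbC.
Qed.

Lemma adj_irr c : irreflexive (adj c).
Proof.
move=> u; rewrite /adj /up; apply/negP; rewrite (_ : _ == _.+1 = false) /=; last by lia.
move=> /and3P[_ _]; have := pos_lt u; by case: (pos u) => [|[|[|[|[|k]]]]].
Qed.

Definition levelgraph c := MkFinGraph (adj_sym c) (adj_irr c).

Lemma levelgraph_inhabited c : inhabited (fvert (levelgraph c)).
Proof. by have [v _] := @vertex_exists 0 0 isT isT; constructor. Qed.

Hypothesis m2 : 1 < m.

Lemma width1 : width 1 = 3. Proof. by rewrite /width /= (ltnW m2). Qed.

Notation Adj c := (fun x y : vertex => adj c x y : Prop).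

Lemma adj_level c u v : adj c u v ->
  [\/ level v = (level u).+1, level u = (level v).+1 | level u = 0 /\ level v = 0].
Proof.
case/or3P=> [/andP[/eqP h _]|/andP[/eqP h _]|/and3P[/eqP h /eqP h' _]].
- exact: Or31.
- exact: Or32.
- exact: Or33.
Qed.

Lemma adj00 c u v : level u = 0 -> level v = 0 -> adj c u v = gadj (pos u) (pos v).
Proof. by rewrite /adj /up => -> ->. Qed.

Lemma adj_up c u v : level v = (level u).+1 -> adj c u v = bit (pos u) (code c v).
Proof.
by move=> h; rewrite /adj /up h eqxx (_ : level u == _ = false) ?andbF ?orbF //=; lia.
Qed.

(** Layer 1 is not the top, so its codes are at most 3 and only bits 0 and 1 can be set. *)
Lemma adj01 c u v : level u = 0 -> adj c u v -> level v = 0 \/ level v = 1 /\ pos u < 2.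
Proof.
move=> u0 uv; have [v1|h|[]] := adj_level uv; try by [lia|left].
right; split; first by lia.
move: uv; rewrite adj_up // /code ifF => [/bit_leq|]; last by lia.
have := pos_lt v; rewrite v1 u0 width1.
by case: (pos u) => [|[|k]] //; rewrite !expnS; have := expn_gt0 2 k; lia.
Qed.

Lemma level0_exists a : a < 5 -> exists v, level v = 0 /\ pos v = a.
Proof. by move=> la; apply: vertex_exists. Qed.

(** An edge outside layer 0 changes the level by exactly one, so by parity a triangle has an edge
    inside layer 0. If its third vertex were in layer 1, that edge would join gadget vertices 0 and
    1, which are not adjacent. *)
Lemma triangle_level0 c u v w : adj c u v -> adj c u w -> adj c v w ->
  [/\ level u = 0, level v = 0 & level w = 0].
Proof.
move=> uv uw vw.
have [vu wu wv] : [/\ adj c v u, adj c w u & adj c w v] by split; rewrite adj_sym.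
have small x y : pos x < 2 -> pos y < 2 -> level x = 0 -> level y = 0 -> adj c x y -> False.
  by move=> hx hy x0 y0; rewrite adj00 //; move: hx hy;
    case: (pos x) => [|[|]] //; case: (pos y) => [|[|]].
have key x y z : adj c x y -> adj c x z -> adj c y z -> level x = 0 -> level y = 0 -> level z = 0.
  move=> xy xz yz x0 y0.
  have [//|[z1 px]] := adj01 x0 xz; have [//|[_ py]] := adj01 y0 yz.
  by case: (small x y).
have [a|a|[u0 v0]] := adj_level uv; [ | |by rewrite u0 v0 (key u v w)].
all: have [b|b|[u0 w0]] := adj_level uw; [ | |by rewrite u0 w0 (key u w v)].
all: have [d|d|[v0 w0]] := adj_level vw; [ | |by rewrite v0 w0 (key v w u)].
all: by clear - a b d; lia.
Qed.

(** * Isolating the gadget vertices *)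

Lemma in_triangleP c v : in_triangle (Adj c) v <-> level v = 0.
Proof.
split=> [[a [b [va vb ab]]]|v0]; first by have [] := triangle_level0 va vb ab.
have H a b : a < 5 -> b < 5 -> gadj (pos v) a -> gadj (pos v) b -> gadj a b ->
    in_triangle (Adj c) v.
  move=> la lb; have [x [x0 <-]] := level0_exists la; have [y [y0 <-]] := level0_exists lb.
  by move=> va vb ab; exists x, y; rewrite !adj00.
have := pos_lt v; rewrite v0 width0.
case E: (pos v) H => [|[|[|[|[|k]]]]] H _ //.
- exact: (H 2 3).
- exact: (H 3 4).
- exact: (H 0 3).
- exact: (H 0 2).
- exact: (H 0 3).
Qed.

Lemma off_triangle_edgeP c v : level v = 0 ->
  off_triangle_edge (Adj c) v <-> pos v < 2.
Proof.
move=> v0; split=> [[y [vy H]]|lt].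
  have [y0|[_ //]] := adj01 v0 vy.
  have Hz a : a < 5 -> gadj (pos v) a -> gadj (pos y) a -> False.
    move=> la; have [z [z0 <-]] := level0_exists la => vz yz.
    by apply: (H z); rewrite !adj00.
  move: vy; rewrite adj00 //; have := pos_lt v; have := pos_lt y; rewrite v0 y0 width0.
  move: Hz; case: (pos v) => [|[|[|[|[|k]]]]] //; case: (pos y) => [|[|[|[|[|l]]]]] // Hz _ _ _;
  by [case: (Hz 0)|case: (Hz 1)|case: (Hz 2)|case: (Hz 3)|case: (Hz 4)].
(* The layer-1 vertex at the same position has code 1 or 2, the singleton consisting of [v]. *)
have [||y [y1 yp]] := @vertex_exists 1 (pos v); first by lia.
  by rewrite width1; lia.
exists y; split.
  by rewrite adj_up ?y1 ?v0 // /code ifF ?yp; [move: lt; case: (pos v) => [|[|]]|lia].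
move=> z [vz yz]; have vy : adj c v y.
  by rewrite adj_up ?y1 ?v0 // /code ifF ?yp; [move: lt; case: (pos v) => [|[|]]|lia].
by have [] := triangle_level0 vy vz yz; lia.
Qed.

(** Gadget vertex 1 has only 3 and 4 as neighbours in layer 0, hence lies in a single triangle. *)
Lemma two_trianglesP c v : level v = 0 -> pos v < 2 ->
  two_triangles (Adj c) v <-> pos v = 0.
Proof.
move=> v0 lt; split=> [[a [b [d [[va vb vd ab bd] nad]]]]|p0].
  have [_ a0 b0] := triangle_level0 va vb ab; have [_ _ d0] := triangle_level0 vb vd bd.
  have nE : pos a <> pos d by move=> E; apply: nad; apply: vertex_inj; rewrite ?a0.
  move: va vb vd ab bd nE; rewrite !adj00 //.
  have := pos_lt a; have := pos_lt b; have := pos_lt d; rewrite a0 b0 d0 width0.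
  move: lt; case: (pos v) => [|[|]] //; case: (pos a) => [|[|[|[|[|?]]]]] //;
  case: (pos b) => [|[|[|[|[|?]]]]] //; by case: (pos d) => [|[|[|[|[|?]]]]].
have [a [a0 pa]] := @level0_exists 2 isT.
have [b [b0 pb]] := @level0_exists 3 isT.
have [d [d0 pd]] := @level0_exists 4 isT.
exists a, b, d; rewrite !adj00 // p0 pa pb pd; split=> // E.
by move: pa; rewrite E pd.
Qed.

(* The formula must not depend on [c]: this is what forces an isomorphism between two
   of the graphs to be the identity. *)
Definition isolated r (v : vertex) :=
  exists2 P : upred, udef r P & forall c w, P vertex (Adj c) w <-> w = v.

Lemma isolated_leq r r' v : r <= r' -> isolated r v -> isolated r' v.
Proof. by move=> le [P hP PE]; exists P => //; apply: udef_leq le hP. Qed.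

Lemma isolated_gadget0 v : level v = 0 -> pos v = 0 -> isolated 3 v.
Proof.
move=> v0 p0; exists (fun W B w =>
  in_triangle B w /\ (off_triangle_edge B w /\ two_triangles B w)).
  apply: udef_and; first exact: udef_leq udef_in_triangle.
  apply: udef_and; first exact: udef_leq udef_off_triangle_edge.
  exact: udef_two_triangles.
move=> c w; rewrite in_triangleP; split=> [[w0 []]|->].
  rewrite off_triangle_edgeP // => lt /two_trianglesP => /(_ w0 lt) q0.
  by apply: vertex_inj; rewrite ?v0 ?p0.
by split=> //; rewrite off_triangle_edgeP // two_trianglesP // p0.
Qed.

Lemma isolated_gadget1 v : level v = 0 -> pos v = 1 -> isolated 3 v.
Proof.
move=> v0 p1; exists (fun W B w =>
  in_triangle B w /\ (off_triangle_edge B w /\ ~ two_triangles B w)).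
  apply: udef_and; first exact: udef_leq udef_in_triangle.
  apply: udef_and; first exact: udef_leq udef_off_triangle_edge.
  exact/udef_not/udef_two_triangles.
move=> c w; rewrite in_triangleP; split=> [[w0 []]|->].
  rewrite off_triangle_edgeP // => lt; rewrite two_trianglesP // => q0.
  by apply: vertex_inj; rewrite ?v0 ?p1 //; lia.
by split=> //; rewrite off_triangle_edgeP // two_trianglesP // p1.
Qed.

Definition inner : upred := fun W B w => in_triangle B w /\ ~ off_triangle_edge B w.

Lemma udef_inner : udef 2 inner.
Proof. exact: udef_and udef_in_triangle (udef_not udef_off_triangle_edge). Qed.

Lemma innerP c w : inner (Adj c) w <-> level w = 0 /\ 1 < pos w.
Proof.
rewrite /inner in_triangleP; split=> -[w0]; rewrite off_triangle_edgeP //; last by lia.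
by move=> h; split=> //; lia.
Qed.

Lemma inner_pos w : level w = 0 -> 1 < pos w -> [\/ pos w = 2, pos w = 3 | pos w = 4].
Proof.
move=> w0; have := pos_lt w; rewrite w0 width0.
by case: (pos w) => [|[|[|[|[|k]]]]] // _ _; [apply: Or31|apply: Or32|apply: Or33].
Qed.

(** Among the inner vertices 2, 3 and 4, only 2 is not adjacent to 1. Next, 3 is the only inner
    neighbour of 2, and 4 is what remains. *)
Lemma isolated_gadget2 v : level v = 0 -> pos v = 2 -> isolated 4 v.
Proof.
move=> v0 p2; have [y [y0 py]] := @level0_exists 1 isT.
have [Y hY YE] := isolated_gadget1 y0 py.
exists (fun W B w => inner B w /\ ~ (exists2 u, B w u & Y W B u)).
  by apply: udef_and; [exact: udef_leq udef_inner|exact/udef_not/udef_nbr].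
move=> c w; rewrite innerP; split=> [[[w0 lt] H]|->].
  have nwy : ~~ adj c w y by apply/negP => h; apply: H; exists y => //; apply/YE.
  apply: vertex_inj; rewrite ?v0 ?p2 //; move: nwy; rewrite adj00 // py.
  by have [] := inner_pos w0 lt => ->.
rewrite v0 p2; split=> // -[u vu /YE uy]; move: vu.
by rewrite uy adj00 // p2 py.
Qed.

Lemma isolated_gadget3 v : level v = 0 -> pos v = 3 -> isolated 5 v.
Proof.
move=> v0 p3; have [u [u0 pu]] := @level0_exists 2 isT.
have [U hU UE] := isolated_gadget2 u0 pu.
exists (fun W B w => inner B w /\ (exists2 u, B w u & U W B u)).
  by apply: udef_and; [exact: udef_leq udef_inner|exact/udef_nbr].
move=> c w; rewrite innerP; split=> [[[w0 lt] [u' wu /UE uE]]|->].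
  apply: vertex_inj; rewrite ?v0 ?p3 //; move: wu; rewrite uE adj00 // pu.
  by have [] := inner_pos w0 lt => ->.
rewrite v0 p3; split=> //; exists u; last exact/UE.
by rewrite adj00 // p3 pu.
Qed.

Lemma isolated_gadget4 v : level v = 0 -> pos v = 4 -> isolated 5 v.
Proof.
move=> v0 p4; have [a [a0 pa]] := @level0_exists 2 isT.
have [b [b0 pb]] := @level0_exists 3 isT.
have [A hA AE] := isolated_gadget2 a0 pa; have [B hB BE] := isolated_gadget3 b0 pb.
exists (fun W E w => inner E w /\ (~ A W E w /\ ~ B W E w)).
  apply: udef_and; first exact: udef_leq udef_inner.
  by apply: udef_and; apply: udef_not => //; apply: udef_leq hA.
move=> c w; rewrite innerP AE BE; split=> [[[w0 lt] [na nb]]|->].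
  apply: vertex_inj; rewrite ?v0 ?p4 //; have [|//|//] := inner_pos w0 lt => pw.
    by case: na; apply: vertex_inj; rewrite ?a0 ?pa.
  by case: nb; apply: vertex_inj; rewrite ?b0 ?pb.
by rewrite v0 p4; split=> //; split=> E; [move: pa|move: pb]; rewrite -E p4.
Qed.

(** * Isolating the higher layers *)

Lemma width_code j v : level v = j.+1 -> j < m ->
  code 0 v < 2 ^ (if j == 0 then 2 else width j).
Proof.
move=> vj lt; rewrite /code ifF; last by lia.
have := pos_lt v; rewrite vj; case: j lt vj => [|j] lt vj; first by rewrite width1.
have E : tower j.+2 = 2 ^ tower j.+1 by [].
have : 1 < 2 ^ tower j.+1 by rewrite -{1}(expn0 2) ltn_exp2l // tower_gt0.
by rewrite /= !width_mid ?expnS -?E; lia.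
Qed.

(** The inner gadget vertices stay out of the induction: they carry no bit of a layer-1 code, and
    the formulas found for them have rank above the 3 wanted at [j = 0]. *)
Definition core (u : vertex) := (0 < level u) || (pos u < 2).

(* A vertex at level [j + 1 <= m] is singled out by its neighbours at level [j], once
   the lower levels have been excluded: higher vertices have no neighbour there. *)
Lemma isolated_core j v : j <= m -> level v <= j -> core v -> isolated (3 + j) v.
Proof.
elim: j v => [|j IH] v jm vj vc.
  have v0 : level v = 0 by lia.
  move: vc; rewrite /core v0 /=; case E: (pos v) => [|[|]] // _.
    exact: isolated_gadget0.
  exact: isolated_gadget1.
have [vj'|vj'] := leqP (level v) j; first by apply: isolated_leq (IH v _ vj' vc); lia.
have {vj'}vj : level v = j.+1 by lia.
(* The predicate [True] is a dummy where the induction hypothesis says nothing; it makes the choice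
   total. *)
have HS u : exists P : upred, level u <= j -> core u ->
    udef (3 + j) P /\ forall c w, P vertex (Adj c) w <-> w = u.
  case lu: (level u <= j); last by exists (fun _ _ _ => True).
  case cu: (core u); last by exists (fun _ _ _ => True).
  by have [|P hP PE] := IH u _ lu cu; [lia|exists P].
have [P HP] := fin_all_exists HS.
have codeE c w : level w = j.+1 -> code c w = (pos w).+1.
  by move=> wj; rewrite /code ifF //; lia.
pose linked u : upred := fun W B w => exists2 y, B w y & P u W B y.
(* The parameter 0 is arbitrary: [v] is below the top, so its links downwards do not depend on
   it. *)
pose fits u : upred := if adj 0 v u then linked u else fun W B w => ~ linked u W B w.
pose low := [seq u <- enum predT | (level u <= j) && core u].
pose below := [seq u <- enum predT | (level u == j) && core u].
have lowP u : (u \in low) = (level u <= j) && core u.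
  by rewrite mem_filter mem_enum andbT.
have belowP u : (u \in below) = (level u == j) && core u.
  by rewrite mem_filter mem_enum andbT.
have fitsE c u w : level u = j -> core u ->
    fits u vertex (Adj c) w <-> adj c w u = bit (pos u) (pos v).+1.
  move=> uj cu; have [_ PE] := HP u (eq_leq uj) cu.
  have lE : linked u vertex (Adj c) w <-> adj c w u.
    by split=> [[y wy /PE <-]|h]; last by exists u => //; apply/PE.
  rewrite /fits adj_sym adj_up ?uj // codeE //.
  by case: (bit _ _); rewrite lE; case: (adj c w u); split=> // -[].
exists (fun W B w => ~ in_triangle B w /\
  ((forall u, u \in low -> ~ P u W B w) /\ (forall u, u \in below -> fits u W B w))).
  apply: udef_and; first by apply: udef_leq (udef_not udef_in_triangle).
  apply: udef_and; apply: udef_conj => u.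
    rewrite lowP => /andP[lu cu]; have [hP _] := HP u lu cu.
    by apply: udef_leq (udef_not hP); lia.
  rewrite belowP => /andP[/eqP uj cu]; have [hP _] := HP u (eq_leq uj) cu.
  rewrite addnS /fits; case: ifP => _; first exact: udef_nbr.
  exact/udef_not/udef_nbr.
move=> c w; rewrite in_triangleP; split=> [[w0 [nlow wfits]]|-> {w}]; last first.
  split; first by lia.
  split=> u.
    by rewrite lowP => /andP[lu cu]; have [_ PE] := HP u lu cu => /PE E; move: lu; rewrite -E vj ltnn.
  rewrite belowP => /andP[/eqP uj cu]; apply/fitsE => //.
  by rewrite adj_sym adj_up ?uj // codeE.
have wc : core w by rewrite /core; lia.
have jw : j < level w.
  rewrite ltnNge; apply/negP => lw; apply: (nlow w); first by rewrite lowP lw.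
  by have [_ ->] := HP w lw wc.
have bitsE u : level u = j -> core u -> adj c w u = bit (pos u) (pos v).+1.
  by move=> uj cu; apply/fitsE => //; apply: wfits; rewrite belowP uj eqxx.
(* The number of bits that layer [j] supplies: the gadget contributes only vertices 0 and 1. *)
pose s := if j == 0 then 2 else width j.
have bound x : level x = j.+1 -> (pos x).+1 < 2 ^ s.
  by move=> xj; rewrite -(codeE 0) //; apply: width_code.
have site i : i < s -> exists2 u, pos u = i & level u = j /\ core u.
  move=> li; have [||u [uj pu]] := @vertex_exists j i; first by lia.
    by move: li; rewrite /s; case: eqP => // ->; rewrite width0; lia.
  by exists u => //; split=> //; rewrite /core uj pu; move: li; rewrite /s; case: (j).
(* The code of [v] is positive, so [v], and with it [w], has a core neighbour in layer [j]. As [w]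
   lies above layer [j], it is in layer [j.+1]. *)
have [i bi] := bit_exists (ltn0Sn (pos v)).
have li : i < s.
  by rewrite -(ltn_exp2l _ _ (isT : 1 < 2)); apply: leq_ltn_trans (bit_leq bi) (bound v vj).
have [u pu [uj cu]] := site i li.
have wj : level w = j.+1.
  have : adj c w u by rewrite bitsE // pu.
  by case/adj_level => [|/esym|]; rewrite ?uj; lia.
apply: vertex_inj; first by rewrite wj vj.
suff [//] : (pos w).+1 = (pos v).+1.
apply: (@bit_inj s) => [||k lk]; [exact: bound|exact: bound|].
have [x px [xj cx]] := site k lk.
by rewrite -px -(codeE c) // -bitsE // adj_sym adj_up ?xj.
Qed.

Lemma isolated_nontop v : level v <= m -> isolated (3 + m) v.
Proof.
move=> vm; case: (posnP (level v)) => [v0|vpos]; last first.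
  by apply: (isolated_core (leqnn m)) => //; rewrite /core vpos.
have := pos_lt v; rewrite v0 width0; case E: (pos v) => [|[|[|[|[|k]]]]] // _.
- by apply: isolated_leq (isolated_gadget0 v0 E); lia.
- by apply: isolated_leq (isolated_gadget1 v0 E); lia.
- by apply: isolated_leq (isolated_gadget2 v0 E); lia.
(* Rank 5 fits under [3 + m] because [1 < m]. *)
- by apply: isolated_leq (isolated_gadget3 v0 E); lia.
- by apply: isolated_leq (isolated_gadget4 v0 E); lia.
Qed.

(* The top vertex is the only one left. *)
Lemma isolated_all v : isolated (3 + m) v.
Proof.
have [|top] := leqP (level v) m; first exact: isolated_nontop.
have vtop : level v = m.+1 by have := level_leq v; lia.
have HS u : exists P : upred, level u <= m ->
    udef (3 + m) P /\ forall c w, P vertex (Adj c) w <-> w = u.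
  case lu: (level u <= m); last by exists (fun _ _ _ => True).
  by have [P hP PE] := isolated_nontop lu; exists P.
have [P HP] := fin_all_exists HS.
pose low := [seq u <- enum predT | level u <= m].
have lowP u : (u \in low) = (level u <= m) by rewrite mem_filter mem_enum andbT.
exists (fun W B w => forall u, u \in low -> ~ P u W B w).
  by apply: udef_conj => u; rewrite lowP => /HP[hP _]; apply: udef_not.
move=> c w; split=> [H|-> u]; last first.
  by rewrite lowP => lu; have [_ PE] := HP u lu => /PE E; move: lu; rewrite -E vtop ltnn.
have wtop : level w = m.+1.
  have := level_leq w; rewrite leq_eqVlt => /orP[/eqP//|]; rewrite ltnS => lw.
  by have [_ PE] := HP w lw; exfalso; apply: (H w); [rewrite lowP|apply/PE].
have := pos_lt w; have := pos_lt v; rewrite wtop vtop width_top => pv pw.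
by apply: vertex_inj; lia.
Qed.

Lemma levelgraph_defines c : exists2 f, defines (levelgraph c) f & qrank f <= m + 5.
Proof.
have HS v : exists P : upred, udef (3 + m) P /\ forall c w, P vertex (Adj c) w <-> w = v.
  by have [P hP PE] := isolated_all v; exists P.
have [P HP] := fin_all_exists HS.
have [f df rf] := @defines_of_isolated (levelgraph c) (3 + m) P
  (fun v => (HP v).1) (fun v => (HP v).2 c).
by exists f => //; lia.
Qed.

(** The isolating predicates do not depend on [c], so an isomorphism fixes every vertex. The links
    of the top vertex to the [(tower m).+1] vertices of layer [m] then spell out the bits of [c]. *)
Lemma levelgraph_iso_inj c c' :
  c < 2 ^ (tower m).+1 -> c' < 2 ^ (tower m).+1 ->
  fiso (levelgraph c) (levelgraph c') -> c = c'.
Proof.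
move=> lc lc' [h [g [hK [gK hE]]]].
have fixed v : h v = v.
  have [P hP PE] := isolated_all v.
  by apply/(PE c'); apply/(udef_iso v hP hK gK hE); apply/(PE c).
apply: bit_inj lc lc' _ => i li.
have [||t [tl _]] := @vertex_exists m.+1 0; rewrite ?width_top //.
have [||u [um pu]] := @vertex_exists m i; rewrite ?width_mid //; try lia.
have E : adj c u t <-> adj c' u t by have := hE u t; rewrite !fixed.
move: E; rewrite !adj_up ?um // /code tl eqxx pu.
by move=> E'; apply/idP/idP => /E'.
Qed.

End Levels.

(** * Orders of the graphs, the numerical bound and the conclusion *)

Lemma card_vertex m : #|vertex m| = \sum_(j < m.+2) width m j.
Proof.
rewrite card_tagged sumnE big_map enumT; apply: eq_bigr => j _.
by rewrite card_ord.
Qed.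

(** Layers up to [m] keep their widths, layer [m.+1] grows and a new top is added. Orders thus
    separate the members of the final family, whatever their codes. *)
Lemma card_vertex_ltn m : 0 < m -> #|vertex m| < #|vertex m.+1|.
Proof.
move=> m0; rewrite !card_vertex (big_ord_recr m.+2) (big_ord_recr m.+1) /=.
rewrite (big_ord_recr m.+1) /=.
rewrite (eq_bigr (fun j : 'I_m.+1 => width m.+1 j)) => [|j _].
  rewrite !width_top width_mid ?leqnn //; have := tower_gt0 m.+1; lia.
by rewrite /width; have := ltn_ord j; case: eqP => // _; rewrite ltnS => le; rewrite le leqW.
Qed.

Lemma card_vertex_inj m n : 0 < m -> 0 < n -> #|vertex m| = #|vertex n| -> m = n.
Proof.
have mono a b : 0 < a -> a < b -> #|vertex a| < #|vertex b|.
  move=> a0; elim: b => // b IH; rewrite ltnS leq_eqVlt => /orP[/eqP<-|ab].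
    exact: card_vertex_ltn.
  by apply: ltn_trans (IH ab) (card_vertex_ltn _); lia.
move=> m0 n0 E; have [lt|lt|//] := ltngtP m n.
  by have := mono _ _ m0 lt; rewrite E ltnn.
by have := mono _ _ n0 lt; rewrite E ltnn.
Qed.

Lemma card_prenex_code_lt K :
  #|prenex_code K| < 2 ^ (2 ^ (2 ^ (2 ^ K.+1))).+1.
Proof.
rewrite card_prenex_code ltn_exp2l // ltnS.
have h n : n < 2 ^ n by exact: ltn_expl.
have h2 : 2 * K.+1 <= 2 ^ K.+1 by rewrite expnS leq_mul2l /= h.
(* With [L = 2 ^ K.+1], the bound [h2] gives both that the square of [L] is at most [2 ^ L] and that
   the square of [2 * K.+1] is at most that of [L]. *)
have h3 : 2 * (K.+1 * K.+1) < 2 ^ (2 ^ K.+1).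
  have : 2 ^ (2 * K.+1) <= 2 ^ (2 ^ K.+1) by rewrite leq_exp2l.
  rewrite mulnC expnM; move: h2; move: (2 ^ K.+1) => L h2.
  have : (2 * K.+1) * (2 * K.+1) <= L * L by apply: leq_mul.
  by rewrite -mulnn; nia.
have h4 : K.+1 + 4 ^ (K.+1 * K.+1) <= 2 ^ (2 * (K.+1 * K.+1)).+1.
  have -> : 4 ^ (K.+1 * K.+1) = 2 ^ (2 * (K.+1 * K.+1)) by rewrite (expnM 2 2).
  have : K.+1 < 2 ^ (2 * (K.+1 * K.+1)).
    by apply: leq_trans (h _) _; rewrite leq_exp2l //; nia.
  by rewrite expnS; lia.
by apply: leq_trans h4 _; rewrite leq_exp2l.
Qed.

Lemma fiso_card (G H : FinGraph) : fiso G H -> #|fvert G| = #|fvert H|.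
Proof. by move=> [h [g [hK [gK _]]]]; apply: (bij_eq_card (Bijective hK gK)). Qed.

Lemma least_value (P : nat -> Prop) : (exists n, P n) ->
  exists n, P n /\ forall k, P k -> n <= k.
Proof.
move=> [n Pn]; apply: NNPP => none.
elim/ltn_ind: n Pn => n IH Pn; apply: none; exists n; split=> // k Pk.
by rewrite leqNgt; apply/negP => lt; apply: IH Pk.
Qed.

Lemma levelgraph_gap i : exists c, exists d dpre,
  [/\ isD (levelgraph i.+3 c) d, isDpre (levelgraph i.+3 c) dpre & tower (d - 8) <= dpre].
Proof.
(* If [K.+1 = tower i], the three inner exponentials of [card_prenex_code_lt] reach [tower m], so
   there are more graphs than codes. The rank bound [m + 5 = i + 8] accounts for the 8. *)
set m := i.+3; have m2 : 1 < m by [].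
have [K KE] : exists K, tower i = K.+1 by exists (tower i).-1; rewrite prednK // tower_gt0.
have [c cP] : exists c, forall f, prenex f -> defines (levelgraph m c) f -> K.+1 <= qrank f.
  have [| | |c cP] := @exists_large_prenex_rank 'I_(2 ^ (tower m).+1) (fun c => levelgraph m c) K.
  - by move=> c; apply: levelgraph_inhabited.
  - by move=> c c' /(levelgraph_iso_inj m2 (ltn_ord c) (ltn_ord c'))/val_inj.
  - by rewrite card_ord; apply: leq_trans (card_prenex_code_lt K) _; rewrite /m /= KE.
  - by exists c.
exists c; have [f df rf] := levelgraph_defines m2 c.
have [d [[g [dg gd]] dmin]] := @least_value
  (fun k => exists f, defines (levelgraph m c) f /\ qrank f = k)
  (ex_intro _ _ (ex_intro _ f (conj df erefl))).
have [h ph dh] := prenex_defines (levelgraph m c).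
have [e [[g' [pg' [dg' ge]]] emin]] := @least_value
  (fun k => exists f, prenex f /\ defines (levelgraph m c) f /\ qrank f = k)
  (ex_intro _ _ (ex_intro _ h (conj ph (conj dh erefl)))).
exists d, e; split.
- by split=> [|f' df']; [exists g|apply: dmin; exists f'].
- by split=> [|f' pf' df']; [exists g'|apply: emin; exists f'].
- rewrite -ge; apply: leq_trans (cP _ pg' dg'); rewrite -KE; apply: tower_leq.
  have : d <= qrank f by apply: dmin; exists f.
  by rewrite /m in rf *; lia.
Qed.

Theorem theorem10p4 :
  exists Gs : nat -> FinGraph,
    (forall i j : nat, i <> j -> ~ fiso (Gs i) (Gs j)) /\
    (forall i : nat,
       0 < #|fvert (Gs i)| /\
       exists d dpre : nat,
         isD (Gs i) d /\ isDpre (Gs i) dpre /\ tower (d - 8) <= dpre).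
Proof.
pose c i := proj1_sig (constructive_indefinite_description _ (levelgraph_gap i)).
exists (fun i => levelgraph i.+3 (c i)); split=> [i j ij /fiso_card|i].
  by move/card_vertex_inj => E; apply: ij; have := E isT isT; lia.
split; first by have [v] := levelgraph_inhabited i.+3 (c i); apply/card_gt0P; exists v.
have [d [e [dP eP le]]] := proj2_sig (constructive_indefinite_description _ (levelgraph_gap i)).
by exists d, e.
Qed.
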